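(* Let $\alpha\in[0,1)$ and let $G$ be a unicyclic graph of order $n\ge 8$. Then $\mu_{\alpha}(G)\ge\mu_{\alpha}(S_n^{+})$, with equality if and only if $G\cong S_n^{+}$.
   Context: All graphs are finite, simple and undirected. A unicyclic graph is a connected graph with exactly one cycle. $S_n^{+}$ is the graph obtained from the star $S_n$ on $n$ vertices by adding an edge between two vertices of degree one. For a connected graph $G$ with distance function $d_G$, the transmission of a vertex $u$ is $T_G(u)=\sum_{v\in V(G)}d_G(u,v)$, $T(G)$ is the diagonal matrix of transmissions and $D(G)=(d_G(u,v))_{u,v\in V(G)}$ the distance matrix. For $\alpha\in[0,1)$, $D_{\alpha}(G)=\alpha T(G)+(1-\alpha)D(G)$, and $\mu_{\alpha}(G)$ (the distance $\alpha$-spectral radius) is the largest eigenvalue of the symmetric matrix $D_{\alpha}(G)$. *)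

(* Defs.v *)
From HB Require Import structures.
From mathcomp Require Import all_boot all_order all_algebra.
From mathcomp Require Import boolp classical_sets reals.

Set Implicit Arguments.
Unset Strict Implicit.
Unset Printing Implicit Defensive.

Import Order.TTheory GRing.Theory Num.Theory.
Local Open Scope ring_scope.

Record sgraph := SGraph {
  svertex :> finType;
  sedge : rel svertex;
  sedge_sym : symmetric sedge;
  sedge_irr : irreflexive sedge }.

Definition isomorphic (G H : sgraph) : Prop :=
  exists f : G -> H,
    bijective f /\ forall x y, sedge (f x) (f y) = sedge x y.

Definition connected_graph (G : sgraph) : Prop :=
  forall x y : G, connect (@sedge G) x y.

(* The edges of the cyclic sequence c; each edge is a 2-element set. *)
Definition cycle_edges (G : sgraph) (c : seq G) : {set {set G}} :=
  [set [set x; next c x] | x in c].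

(* A cycle is a subgraph without isolated vertices, so it is identified with
   its edge set: all rotations and reversals of a vertex sequence c give the
   same cycle. *)
Definition is_cycle (G : sgraph) (C : {set {set G}}) : Prop :=
  exists c : seq G,
    [/\ (3 <= size c)%N, ucycle (@sedge G) c & C = cycle_edges c].

Definition unicyclic (G : sgraph) : Prop :=
  connected_graph G /\ exists! C : {set {set G}}, is_cycle C.

Definition has_walk (G : sgraph) (x y : G) (k : nat) : bool :=
  [exists p : k.-tuple G, path (@sedge G) x p && (last x p == y)].

(* The least length of a walk from x to y.  A shortest walk has length less
   than #|G|; the value is #|G| when y is not reachable from x. *)
Definition dist (G : sgraph) (x y : G) : nat :=
  find (has_walk x y) (iota 0 #|G|).

Definition transmission (G : sgraph) (u : G) : nat :=
  (\sum_(v : G) dist u v)%N.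

Definition distance_mx (R : realType) (G : sgraph) : 'M[R]_#|G| :=
  \matrix_(i, j) (dist (enum_val i) (enum_val j))%:R.

Definition transmission_mx (R : realType) (G : sgraph) : 'M[R]_#|G| :=
  diag_mx (\row_i (transmission (enum_val i))%:R).

Definition alpha_distance_mx (R : realType) (alpha : R) (G : sgraph) :
    'M[R]_#|G| :=
  alpha *: transmission_mx R G + (1 - alpha) *: distance_mx R G.

(* A matrix has finitely many eigenvalues, and a real symmetric matrix of
   positive order has at least one, so this supremum is a maximum. *)
Definition alpha_spectral_radius (R : realType) (alpha : R) (G : sgraph) : R :=
  sup [set a : R | eigenvalue (alpha_distance_mx alpha G) a]%classic.

Definition star_edge (n : nat) : rel 'I_n :=
  fun i j => (i != j) && ((val i == 0%N) || (val j == 0%N)).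

(* The added edge joins the leaves 1 and 2 of the star with centre 0; by
   symmetry any other pair of leaves gives an isomorphic graph. *)
Definition star_plus_edge (n : nat) : rel 'I_n :=
  fun i j => [|| star_edge i j, (val i == 1%N) && (val j == 2%N)
                              | (val i == 2%N) && (val j == 1%N)].

Lemma star_plus_edge_sym (n : nat) : symmetric (@star_plus_edge n).
Proof.
move=> i j; rewrite /star_plus_edge /star_edge eq_sym.
by congr (_ && _ || _); rewrite orbC // ![_ && (val i == _)]andbC.
Qed.

Lemma star_plus_edge_irr (n : nat) : irreflexive (@star_plus_edge n).
Proof.
by move=> i; rewrite /star_plus_edge /star_edge eqxx; case: i => -[|[|[|m]]].
Qed.

Definition star_plus (n : nat) : sgraph :=
  SGraph (@star_plus_edge_sym n) (@star_plus_edge_irr n).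

(* Main.v *)
(* Let W be the sum of all distances over ordered pairs of vertices.  The Rayleigh
   quotient at the all-ones vector gives mu(G) >= W(G)/n, while a test vector
   slightly smaller at the centre gives mu(S_n^+) < 2n - 3.  It is thus enough to
   find n ordered pairs at distance at least 3 in every other unicyclic G, since
   G has n edges and so W(G) >= 2n(n-1) - 2n + (number of such pairs).  If every
   vertex has a vertex at distance at least 3, this is clear.  Otherwise take a
   vertex u of eccentricity at most 2 having maximum degree k among such vertices:
   G is a tree of depth 2 rooted at u plus one edge.  If k >= 3, a vertex at
   distance 2 from u is within distance 2 of at most two neighbours of u, leaving
   2(n-1-k)(k-2) >= 2(n-4) >= n far ordered pairs unless k = n-1, in which case G is
   S_n^+.  By the choice of u, k = 2 if k < 3, and both branches at u are then
   nonempty; far pairs are found between them. *)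
Require Import Defs.
(* In this order, finset owns the notations it shares with classical_sets. *)
From mathcomp Require Import boolp classical_sets reals.
From mathcomp Require Import all_boot all_order all_algebra.
From mathcomp Require Import complex zify ring lra.

Set Implicit Arguments.
Unset Strict Implicit.
Unset Printing Implicit Defensive.

Import Order.TTheory GRing.Theory Num.Theory.
Local Open Scope ring_scope.

(** * Spectral bounds for real matrices *)

(** The Rayleigh quotient of the all-ones vector is a weighted mean of the eigenvalues. The matrix
    is embedded in [R[i]] in order to apply the complex spectral theorem. *)
Lemma exists_eigenvalue_ge_mean (R : rcfType) (m : nat) (A : 'M[R]_m) :
  (0 < m)%N -> A^T = A ->
  exists2 a, eigenvalue A a & \sum_i \sum_j A i j <= a * m%:R.
Proof.
move=> m_gt0 symA; apply: contrapT => noev.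
have ltev a : eigenvalue A a -> a * m%:R < \sum_i \sum_j A i j.
  by move=> eva; rewrite ltNge; apply/negP => le; apply: noev; exists a.
pose B := map_mx (real_complex R) A; pose P := spectralmx B.
pose d := spectral_diag B.
have hermB : B \is hermsymmx.
  apply: realsym_hermsym.
    apply/is_hermitianmxP; rewrite expr0 scale1r map_mx_id //.
    by rewrite /B map_trmx symA.
  by apply/mxOverP => i j; rewrite mxE; apply/complex_realP; exists (A i j).
have Punit : P \in unitmx := spectral_unit B.
have defB : B = invmx P *m diag_mx d *m P.
  exact/orthomx_spectralP/hermitian_normalmx.
(* Row [i] of [P] is an eigenvector of [B]; its real eigenvalue descends to [A] because the
   characteristic polynomial commutes with the embedding. *)
have evd i : exists2 k, d 0 i = k%:C%C & eigenvalue A k.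
  have /mxOverP/(_ 0 i)/complex_realP[k dk] := hermitian_spectral_diag_real hermB.
  exists k => //.
  have : eigenvalue B (k%:C)%C.
    apply/eigenvalueP; exists (row i P).
      rewrite defB !mulmxA -[row i P *m _]row_mul mulmxV // row1 -rowE.
      by rewrite row_diag_mx -dk -scalemxAl rowE.
    apply/negP => /eqP r0; have /row_freeP[Q PQ] : row_free P by rewrite row_free_unit.
    have := congr1 (row i) PQ; rewrite row_mul r0 mul0mx row1 => /rowP/(_ i).
    by rewrite !mxE !eqxx => /eqP; rewrite eq_sym oner_eq0.
  by rewrite !eigenvalue_root_char -map_char_poly fmorph_root.
pose v : 'rV[R[i]]_m := const_mx 1.
pose w := v *m invmx P.
have invP : invmx P = map_mx Num.conj P^T.
  exact/invmx_unitary/spectral_unitarymx.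
have wE i : (P *m v^T) i 0 = (w 0 i)^*.
  rewrite !mxE rmorph_sum /=; apply: eq_bigr => j _.
  by rewrite invP !mxE mulr1 mul1r conjCK.
have sum_w : \sum_i `|w 0 i| ^+ 2 = m%:R :> R[i].
  have : (v *m v^T) 0 0 = m%:R.
    rewrite mxE (eq_bigr (fun=> 1)) ?sumr_const ?card_ord // => i _.
    by rewrite !mxE mulr1.
  rewrite -{1}[v](mulmxKV Punit) -/w -mulmxA mxE => <-.
  by apply: eq_bigr => i _; rewrite wE normCK.
have sum_dw : \sum_i d 0 i * `|w 0 i| ^+ 2 = (\sum_i \sum_j A i j)%:C%C.
  have : (v *m B *m v^T) 0 0 = (\sum_i \sum_j A i j)%:C%C.
    rewrite exchange_big /= mxE rmorph_sum /=; apply: eq_bigr => i _.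
    rewrite !mxE mulr1 rmorph_sum /=; apply: eq_bigr => j _.
    by rewrite !mxE mul1r.
  rewrite defB !mulmxA -/w -mulmxA mxE => <-; apply: eq_bigr => i _.
  by rewrite wE mul_mx_diag mxE normCK mulrA [d 0 i * _]mulrC.
pose S := \sum_i \sum_j A i j.
(* By [ltev] each coefficient of [|w 0 i| ^+ 2] is positive, yet the terms sum to 0. Hence [w]
   vanishes, against [sum_w]. *)
have pos i : 0 <= (S%:C%C - d 0 i * m%:R) * `|w 0 i| ^+ 2.
  rewrite mulr_ge0 ?exprn_ge0 // subr_ge0.
  have [k -> /ltev/ltW] := evd i.
  by rewrite -(rmorph_nat (real_complex R)) -rmorphM lecR.
have sum0 : \sum_i (S%:C%C - d 0 i * m%:R) * `|w 0 i| ^+ 2 = 0.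
  under eq_bigr do rewrite mulrBl.
  rewrite sumrB -mulr_sumr sum_w.
  under eq_bigr do rewrite mulrAC.
  by rewrite -mulr_suml sum_dw subrr.
have w0 i : `|w 0 i| ^+ 2 = 0.
  have /eqP := psumr_eq0P (fun j _ => pos j) sum0 (i := i) isT.
  have [k -> /ltev] := evd i => ltk.
  rewrite mulf_eq0 subr_eq0 => /orP[/eqP|/eqP //].
  rewrite -(rmorph_nat (real_complex R)) -rmorphM => /complexI eqS.
  by move: ltk; rewrite -eqS ltxx.
move: sum_w; rewrite big1 // => /esym/eqP.
by rewrite pnatr_eq0 => /eqP m0; rewrite m0 in m_gt0.
Qed.

(** Collatz-Wielandt bound: at an index [i] maximising [|f i| / y i], the eigenvalue equation gives
    [|lambda| * |f i| <= c * |f i|]. *)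
Lemma eigenvalue_le_of_test_vector (R : realFieldType) (I : finType)
    (a : I -> I -> R) (y f : I -> R) (c lambda : R) :
  (forall i j, 0 <= a i j) -> (forall i, 0 < y i) ->
  (forall i, \sum_j a i j * y j <= c * y i) ->
  (exists i, f i != 0) -> (forall i, \sum_j a i j * f j = lambda * f i) ->
  lambda <= c.
Proof.
move=> a0 y0 ay [i0 fi0] af.
have [i _ maxi] := @arg_maxP _ R I i0 predT (fun i => `|f i| / y i) isT.
set t := `|f i| / y i in maxi.
have tpos : 0 < t.
  by apply: lt_le_trans (maxi i0 isT); rewrite divr_gt0 ?normr_gt0.
have lef j : `|f j| <= t * y j by rewrite -ler_pdivrMr //; apply: maxi.
have fi : `|f i| = t * y i by rewrite /t divfK // gt_eqF.
have : `|lambda * f i| <= t * (c * y i).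
  rewrite -af; apply: le_trans (ler_norm_sum _ _ _) _.
  apply: le_trans (ler_wpM2l (ltW tpos) (ay i)).
  rewrite mulr_sumr; apply: ler_sum => j _.
  by rewrite normrM ger0_norm // mulrCA ler_wpM2l.
rewrite normrM fi mulrCA ler_pM2l // ler_pM2r //.
exact: le_trans (ler_norm _).
Qed.

(** * Walks, distances and isomorphism *)

Lemma has_walk_sym (G : sgraph) (x y : G) (k : nat) :
  has_walk x y k = has_walk y x k.
Proof.
suff imp (u v : G) : has_walk u v k -> has_walk v u k.
  by apply/idP/idP; apply: imp.
case/existsP => p /andP[pth /eqP lst]; apply/existsP.
exists [tuple of rev (belast u p)]; apply/andP; split.
  rewrite -lst (eq_path (e' := fun z => (@sedge G)^~ z)) ?rev_path //.
  by move=> a b; rewrite sedge_sym.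
apply/eqP; rewrite -lst /=; case: (p : seq G) => [|a s] //=.
by rewrite rev_cons last_rcons.
Qed.

Lemma dist_sym (G : sgraph) (x y : G) : dist x y = dist y x.
Proof. by apply: eq_find => k; apply: has_walk_sym. Qed.

Lemma dist_le (G : sgraph) (x y : G) (k : nat) :
  has_walk x y k -> (dist x y <= k)%N.
Proof.
(* For [k >= #|G|] the bound holds because [dist] never exceeds its default value [#|G|]. *)
move=> w; case: (ltnP k #|G|) => [k_lt|]; last first.
  by apply: leq_trans; rewrite -[leqRHS](size_iota 0) find_size.
rewrite leqNgt; apply/negP => /(before_find 0%N).
by rewrite nth_iota // add0n w.
Qed.

Lemma dist_walk (G : sgraph) (x y : G) :
  (dist x y < #|G|)%N -> has_walk x y (dist x y).
Proof.
move=> lt; have /(nth_find 0%N) : has (has_walk x y) (iota 0 #|G|).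
  by rewrite has_find size_iota.
by rewrite nth_iota.
Qed.

Lemma dist_eq0 (G : sgraph) (x y : G) : (dist x y == 0%N) = (x == y).
Proof.
apply/eqP/eqP => [d0|->]; last first.
  apply/eqP; rewrite -leqn0; apply: dist_le; apply/existsP.
  by exists [tuple]; rewrite /= eqxx.
have /dist_walk : (dist x y < #|G|)%N by rewrite d0; apply/card_gt0P; exists x.
by rewrite d0 => /existsP[p]; rewrite tuple0 => /andP[_ /eqP].
Qed.

Lemma dist_isomorphic (G H : sgraph) (f : G -> H) :
  bijective f -> (forall x y, sedge (f x) (f y) = sedge x y) ->
  forall x y, dist (f x) (f y) = dist x y.
Proof.
move=> bij_f fE x y; rewrite /dist (bij_eq_card bij_f); apply: eq_find => k.
case: bij_f => g fK gK.
have tupK (p : k.-tuple H) : exists q : k.-tuple G, p = [tuple of map f q].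
  exists [tuple of map g p]; apply: val_inj.
  by rewrite /= -map_comp map_id_in // => z _; apply: gK.
have mapE (q : k.-tuple G) :
    path (@sedge H) (f x) [tuple of map f q] && (last (f x) [tuple of map f q] == f y)
    = path (@sedge G) x q && (last x q == y).
  rewrite /= last_map (inj_eq (can_inj fK)) path_map; congr andb.
  exact: eq_path.
apply/existsP/existsP => [[p pP]|[q qP]]; last first.
  by exists [tuple of map f q]; rewrite mapE.
by have [q qE] := tupK p; exists q; rewrite -mapE -qE.
Qed.

Lemma transmission_isomorphic (G H : sgraph) (f : G -> H) :
  bijective f -> (forall x y, sedge (f x) (f y) = sedge x y) ->
  forall x, transmission (f x) = transmission x.
Proof.
move=> bij_f fE x; rewrite /transmission (reindex f) /=; last exact: onW_bij.
by apply: eq_bigr => y _; apply: dist_isomorphic.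
Qed.

(** * The distance matrix and its spectral radius *)

(** Indexing the matrix entries by vertices instead of ordinals keeps [enum_val] out of the later
    sums. *)
Definition alpha_distance (R : realType) (alpha : R) (G : sgraph) (x y : G) : R :=
  alpha * (transmission x)%:R *+ (x == y) + (1 - alpha) * (dist x y)%:R.

Lemma alpha_distance_mxE (R : realType) (alpha : R) (G : sgraph) i j :
  alpha_distance_mx alpha G i j = alpha_distance alpha (enum_val i) (enum_val j).
Proof. by rewrite /alpha_distance !mxE -mulrnAr (inj_eq enum_val_inj). Qed.

Lemma alpha_distance_sym (R : realType) (alpha : R) (G : sgraph) (x y : G) :
  alpha_distance alpha x y = alpha_distance alpha y x.
Proof.
by rewrite /alpha_distance dist_sym [x == y]eq_sym; case: eqP => [->|].
Qed.

Lemma alpha_distance_ge0 (R : realType) (alpha : R) (G : sgraph) (x y : G) :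
  0 <= alpha <= 1 -> 0 <= alpha_distance alpha x y.
Proof.
case/andP=> a0 a1; rewrite addr_ge0 ?mulrn_wge0 ?mulr_ge0 //.
by rewrite subr_ge0.
Qed.

(** The diagonal contributes the share [alpha] of the transmission and the distances the share
    [1 - alpha], so [alpha] cancels. *)
Lemma sum_alpha_distance (R : realType) (alpha : R) (G : sgraph) (x : G) :
  \sum_y alpha_distance alpha x y = (transmission x)%:R.
Proof.
rewrite big_split /= -mulr_sumr -natr_sum -/(transmission x).
rewrite (bigD1 x) //= eqxx big1 ?addr0 => [|y /negPf].
  by rewrite mulr1n -mulrDl addrC subrK mul1r.
by rewrite eq_sym => ->.
Qed.

Lemma eigenvalue_alpha_distanceP (R : realType) (alpha : R) (G : sgraph) (l : R) :
  eigenvalue (alpha_distance_mx alpha G) l <->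
  exists f : G -> R, (exists x, f x != 0) /\
    forall x, \sum_y alpha_distance alpha x y * f y = l * f x.
Proof.
split=> [/eigenvalueP[v vA v0]|[f [[x fx] fA]]].
  exists (fun x => v 0 (enum_rank x)); split.
    have /rV0Pn[i vi] := v0; exists (enum_val i).
    by rewrite enum_valK.
  move=> x; have /rowP/(_ (enum_rank x)) := vA; rewrite !mxE => <-.
  rewrite (reindex (@enum_val G predT)) /=; last exact/onW_bij/enum_val_bij.
  apply: eq_bigr => i _.
  by rewrite alpha_distance_mxE enum_rankK enum_valK alpha_distance_sym mulrC.
apply/eigenvalueP; exists (\row_i f (enum_val i)).
  apply/rowP => j; rewrite !mxE -fA.
  rewrite [RHS](reindex (@enum_val G predT)) /=; last exact/onW_bij/enum_val_bij.
  by apply: eq_bigr => i _; rewrite mxE alpha_distance_mxE alpha_distance_sym mulrC.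
by apply/rV0Pn; exists (enum_rank x); rewrite mxE enum_rankK.
Qed.

Lemma alpha_spectral_radius_isomorphic (R : realType) (alpha : R) (G H : sgraph) :
  isomorphic G H -> alpha_spectral_radius alpha G = alpha_spectral_radius alpha H.
Proof.
case=> f [bij_f fE]; congr sup; apply/seteqP; split=> l /=.
  move/eigenvalue_alpha_distanceP => [v [[x vx] vA]].
  have [g fK gK] := bij_f.
  apply/eigenvalue_alpha_distanceP; exists (v \o g); split.
    by exists (f x); rewrite /= fK.
  move=> y; rewrite -(gK y) /= fK -vA (reindex f) /=; last exact: onW_bij.
  apply: eq_bigr => z _; rewrite fK /alpha_distance transmission_isomorphic //.
  by rewrite dist_isomorphic // (bij_eq bij_f).
move/eigenvalue_alpha_distanceP => [v [[x vx] vA]].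
have [g fK gK] := bij_f.
apply/eigenvalue_alpha_distanceP; exists (v \o f); split.
  by exists (g x); rewrite /= gK.
move=> y; rewrite -vA (reindex f) /=; last exact: onW_bij.
apply: eq_bigr => z _; rewrite /alpha_distance transmission_isomorphic //.
by rewrite dist_isomorphic // (bij_eq bij_f).
Qed.

Lemma eigenvalue_le_alpha_spectral_radius (R : realType) (alpha : R)
    (G : sgraph) (l : R) :
  0 <= alpha <= 1 -> eigenvalue (alpha_distance_mx alpha G) l ->
  l <= alpha_spectral_radius alpha G.
Proof.
move=> a01 evl; apply: (@ub_le_sup R [set a | eigenvalue _ a]%classic) => //.
(* The eigenvalues are bounded: for the all-ones test vector, each row sum is at most the sum of all
   entries. *)
exists (\sum_x \sum_y alpha_distance alpha (x : G) y).
move=> k /= /eigenvalue_alpha_distanceP[f [f0 fA]].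
apply: (@eigenvalue_le_of_test_vector R G (@alpha_distance R alpha G) (fun=> 1) f) => //.
  by move=> x y; apply: alpha_distance_ge0.
move=> x; rewrite mulr1 [leRHS](bigD1 x) //=.
under eq_bigr do rewrite mulr1.
rewrite lerDl; apply: sumr_ge0 => z _; apply: sumr_ge0 => y _.
exact: alpha_distance_ge0.
Qed.

Lemma sum_transmission_le (R : realType) (alpha : R) (G : sgraph) :
  0 <= alpha <= 1 -> (0 < #|G|)%N ->
  (\sum_(x : G) transmission x)%:R <= alpha_spectral_radius alpha G * #|G|%:R.
Proof.
move=> a01 G0.
have [|l evl] := @exists_eigenvalue_ge_mean R _ (alpha_distance_mx alpha G) G0.
  apply/matrixP => i j; rewrite mxE !alpha_distance_mxE.
  exact: alpha_distance_sym.
have -> : \sum_i \sum_j alpha_distance_mx alpha G i j =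
    (\sum_(x : G) transmission x)%:R.
  rewrite natr_sum (reindex (@enum_val G predT)) /=; last exact/onW_bij/enum_val_bij.
  apply: eq_bigr => i _; rewrite -(sum_alpha_distance alpha).
  rewrite [RHS](reindex (@enum_val G predT)) /=; last exact/onW_bij/enum_val_bij.
  by apply: eq_bigr => j _; rewrite alpha_distance_mxE.
move/le_trans; apply; apply: ler_wpM2r => //.
exact: eigenvalue_le_alpha_spectral_radius.
Qed.

Lemma alpha_spectral_radius_le (R : realType) (alpha : R) (G : sgraph)
    (y : G -> R) (c : R) :
  0 <= alpha <= 1 -> (0 < #|G|)%N -> (forall x, 0 < y x) ->
  (forall x, \sum_z alpha_distance alpha x z * y z <= c * y x) ->
  alpha_spectral_radius alpha G <= c.
Proof.
move=> a01 G0 y0 yc; apply: ge_sup.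
  have [|l evl _] := @exists_eigenvalue_ge_mean R _ (alpha_distance_mx alpha G) G0.
    apply/matrixP => i j; rewrite mxE !alpha_distance_mxE.
    exact: alpha_distance_sym.
  by exists l.
move=> l /= /eigenvalue_alpha_distanceP[f [f0 fA]].
apply: eigenvalue_le_of_test_vector f0 fA => // x z.
exact: alpha_distance_ge0.
Qed.

(** * The spectral radius of the star with an extra edge *)

Lemma star_plus_dist0 (n : nat) (i j : star_plus n) :
  val i = 0%N -> (dist i j <= (i != j))%N.
Proof.
move=> i0; case: (eqVneq i j) => [<-|neq /=]; first by rewrite leqn0 dist_eq0.
apply: dist_le; apply/existsP; exists [tuple j].
by rewrite /= eqxx !andbT /star_plus_edge /star_edge neq i0.
Qed.

(** All pairs are joined through the centre. The edge between 1 and 2 is ignored, since an upper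
    bound suffices. *)
Lemma star_plus_dist_le (n : nat) (i j : star_plus n) :
  (dist i j <= ((i != j) + ((i != j) && (val i != 0%N) && (val j != 0%N))))%N.
Proof.
case: (eqVneq i j) => [<-|neq]; first by rewrite leqn0 dist_eq0.
have [i0|i0] := eqVneq (val i) 0%N.
  by apply: leq_trans (star_plus_dist0 _ i0) _; rewrite neq.
have [j0|j0] := eqVneq (val j) 0%N.
  by rewrite dist_sym; apply: leq_trans (star_plus_dist0 _ j0) _; case: (_ != _).
have n0 : (0 < n)%N by case: (n) i {neq i0} => [[]|].
apply: dist_le; apply/existsP; exists [tuple Ordinal n0 : star_plus n; j].
rewrite /= eqxx !andbT /star_plus_edge /star_edge /=.
by rewrite -!val_eqE /= i0 orbT /= [(0%N == _)]eq_sym j0.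
Qed.

Lemma star_plus_transmission_centre (n : nat) (i : star_plus n) :
  val i = 0%N -> (transmission i <= n.-1)%N.
Proof.
move=> i0; apply: leq_trans (_ : (\sum_(j : star_plus n) (i != j) <= _)%N).
  by apply: leq_sum => j _; apply: star_plus_dist0.
rewrite -big_mkcond sum1_card (eq_card (B := predC1 i)) => [|j].
  by rewrite cardC1 card_ord.
by rewrite !inE eq_sym.
Qed.

Lemma star_plus_transmission (n : nat) (i : star_plus n) :
  (transmission i <= 2 * n - 3)%N.
Proof.
have n0 : (0 < n)%N by case: (n) i => [[]|].
case: (eqVneq (val i) 0%N) => [i0|i0].
  by apply: leq_trans (star_plus_transmission_centre i0) _; lia.
pose o : star_plus n := Ordinal n0.
rewrite /transmission (bigD1 i) //= (bigD1 o) /=; last by rewrite -val_eqE /= eq_sym.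
have -> : dist i i = 0%N by apply/eqP; rewrite dist_eq0.
have := star_plus_dist_le i o; rewrite andbF addn0 => /leq_trans/(_ (leq_b1 _)) le1.
have : (\sum_(j : star_plus n | (j != i) && (j != o)) dist i j <=
  \sum_(j : star_plus n | (j != i) && (j != o)) 2)%N.
  apply: leq_sum => j _; apply: leq_trans (star_plus_dist_le i j) _.
  by rewrite -[2%N]/(1 + 1)%N leq_add ?leq_b1.
rewrite sum_nat_const (eq_card (B := predC (pred2 i o))); last first.
  by move=> j; rewrite !inE negb_or.
have : (2 + #|predC (pred2 i o)| = n)%N.
  by have := cardC (pred2 i o); rewrite card2 card_ord -val_eqE /= i0.
move: le1; set d := dist i o; set k := #|_|; set s := (\sum_(_ | _) _)%N.
lia.
Qed.

Lemma star_plus_radius_lt (R : realType) (alpha : R) (n : nat) :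
  0 <= alpha < 1 -> (3 <= n)%N ->
  alpha_spectral_radius alpha (star_plus n) < (2 * n - 3)%:R.
Proof.
case/andP=> a0 a1 n3; have a01 : 0 <= alpha <= 1 by rewrite a0 ltW.
(* Lowering the test vector by 1/4 at the centre lowers every other row by at least
   [(1 - alpha) / 4], whence [e]. The centre row has room to spare: [n - 1 <= 3/4 * (2 * n - 3 - e)]
   for [n >= 3]. *)
pose e : R := (1 - alpha) / 4; have e0 : 0 < e by rewrite divr_gt0 ?subr_gt0.
apply: le_lt_trans (_ : (2 * n - 3)%:R - e < _); last by rewrite ltrBlDr ltrDl.
have n0 : (0 < n)%N by lia.
pose o : star_plus n := Ordinal n0.
pose y (i : star_plus n) : R := 1 - (i == o)%:R / 4.
have sumE i : \sum_z alpha_distance alpha i z * y z =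
    (transmission i)%:R - alpha_distance alpha i o / 4.
  rewrite -(sum_alpha_distance alpha) [in RHS](bigD1 o) //= (bigD1 o) //=.
  rewrite /y eqxx mulrBr !mulr1 mul1r addrAC; congr (_ + _ - _).
  by apply: eq_bigr => z /negPf ->; rewrite mul0r subr0 mulr1.
apply: (alpha_spectral_radius_le (y := y)); rewrite ?card_ord // => i.
  by rewrite /y; case: (i == o) => /=; lra.
rewrite sumE /y; case: (eqVneq i o) => [->|io].
  have h1 : (transmission o)%:R <= (n.-1)%:R :> R.
    by rewrite ler_nat star_plus_transmission_centre.
  have h2 := alpha_distance_ge0 o o a01.
  have h3 : (3 : R) <= n%:R by rewrite ler_nat.
  move: h1; rewrite -subn1 !natrB ?natrM; try lia.
  by rewrite /e /=; lra.
have h1 : (transmission i)%:R <= (2 * n - 3)%:R :> R.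
  by rewrite ler_nat star_plus_transmission.
have : 1 - alpha <= alpha_distance alpha i o.
  rewrite /alpha_distance (negPf io) mulr0n add0r ler_peMr ?subr_ge0 ?(ltW a1) //.
  by rewrite ler1n lt0n dist_eq0.
rewrite /e /=; lra.
Qed.

(** * Counting the edges of forests and unicyclic graphs *)

(** Otherwise every vertex of [S] has two neighbours in [S], and a simple path can be extended at
    its head beyond [#|T|] vertices: a neighbour already on the path would close a cycle. *)
Lemma acyclic_has_leaf (T : finType) (e : rel T) (S : {set T}) :
  symmetric e -> irreflexive e -> (forall c, (3 <= size c)%N -> ~ ucycle e c) ->
  S != set0 -> exists2 v, v \in S & (#|[set y in S | e v y]| <= 1)%N.
Proof.
move=> e_sym e_irr acyc /set0Pn[v0 v0S].
apply: contrapT => noleaf.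
have deg2 v : v \in S -> (1 < #|[set y in S | e v y]|)%N.
  by move=> vS; rewrite ltnNge; apply/negP => le1; apply: noleaf; exists v.
have long k : exists x p, [/\ size p = k, uniq (x :: p), path e x p & x \in S].
  elim: k => [|k [x [p [sz un pth xS]]]]; first by exists v0, [::].
  (* Leave [x] by a vertex other than the next one on the path. For empty [p] the default [x]
     excludes nothing, as [e] is irreflexive. *)
  have [y] : exists y, y \in [set y in S | e x y] :\ head x p.
    apply/card_gt0P; have := deg2 _ xS.
    by rewrite (cardsD1 (head x p)); case: (_ \in _) => //= /ltnW.
  rewrite !inE => /and3P[y_head yS exy].
  have [y_in|y_notin] := boolP (y \in x :: p); last first.
    by exists y, (x :: p); rewrite /= sz e_sym exy; split=> //; apply/andP.
  move: y_in; rewrite inE => /orP[/eqP yx|y_in].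
    by rewrite yx e_irr in exy.
  case/splitPr: y_in sz un pth y_head => p1 p2 sz un pth y_head.
  case: p1 sz un pth y_head => [|z p1] sz un pth y_head.
    by rewrite /= eqxx in y_head.
  (* The path from [x] to [y] closes up; as [y] is not its second vertex, the cycle has length at
     least 3. *)
  exfalso; apply: (acyc (x :: z :: rcons p1 y)); first by rewrite /= size_rcons.
  apply/andP; split.
    move: pth; rewrite /= cat_path /= !rcons_path last_rcons.
    by case/and3P=> -> -> /andP[-> _]; rewrite e_sym exy.
  by move: un; rewrite -cat_rcons -cat_cons cat_uniq => /andP[].
have [x [p [sz un _ _]]] := long #|T|.
by have := max_card (mem (x :: p)); rewrite (card_uniqP un) /= sz ltnn.
Qed.

(** Each edge is counted twice. Removing a vertex with at most one neighbour in [S] lowers the sum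
    by at most 2. *)
Lemma acyclic_edge_count (T : finType) (e : rel T) (S : {set T}) :
  symmetric e -> irreflexive e -> (forall c, (3 <= size c)%N -> ~ ucycle e c) ->
  (\sum_(x in S) \sum_(y in S) e x y <= 2 * #|S|.-1)%N.
Proof.
move=> e_sym e_irr acyc; have [n] := ubnP #|S|.
elim: n S => // n IHn S; rewrite ltnS => S_le.
have [->|S0] := eqVneq S set0; first by rewrite big_set0.
have [v vS deg_v] := acyclic_has_leaf e_sym e_irr acyc S0.
have S_card := cardsD1 v S; rewrite vS in S_card.
have [S'0|S'0] := eqVneq (S :\ v) set0.
  have -> : S = [set v].
    by rewrite -(setD1K vS) S'0 setU0.
  by rewrite !big_set1 e_irr.
have degE : (\sum_(y in S :\ v) e v y <= 1)%N.
  apply: leq_trans deg_v; rewrite -sum1dep_card big_mkcond [leqRHS]big_mkcond.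
  apply: leq_sum => y _; rewrite !inE.
  by case: (y != v); case: (y \in S); case: (e v y).
have : (#|S :\ v| < n)%N by lia.
move/(IHn _); move: S'0; rewrite -card_gt0 => S'0 IH.
rewrite (big_setD1 v vS) /= (big_setD1 v vS) /= e_irr.
under [X in (_ + X)%N]eq_bigr => x xS do rewrite (big_setD1 v vS) /= e_sym.
rewrite big_split /=; lia.
Qed.

Lemma sum_rel_card (T : finType) (r : rel T) :
  (\sum_x \sum_y r x y = #|[set p | r p.1 p.2]|)%N.
Proof.
by rewrite pair_big -sum1dep_card [RHS]big_mkcond; apply: eq_bigr => p _; case: r.
Qed.

(** Deleting one edge [{s, t}] of the unique cycle leaves a forest; restoring it adds two ordered
    pairs. *)
Lemma unicyclic_edge_count (G : sgraph) :
  unicyclic G -> (\sum_(x : G) \sum_(y : G) sedge x y <= 2 * #|G|)%N.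
Proof.
case=> _ [C [[c [c3 c_cyc CE]] C_uniq]].
case: c c3 c_cyc CE => // s c c3 c_cyc CE; set t := next (s :: c) s in CE.
pose e' : rel G := fun x y => sedge x y && ([set x; y] != [set s; t]).
have e'_sym : symmetric e' by move=> x y; rewrite /e' sedge_sym setUC.
have e'_irr : irreflexive e' by move=> x; rewrite /e' sedge_irr.
have stC : [set s; t] \in C by rewrite CE; apply/imsetP; exists s; rewrite ?mem_head.
(* A cycle of [e'] is a cycle of [G], so it equals [C] and contains the deleted edge. *)
have acyc c' : (3 <= size c')%N -> ~ ucycle e' c'.
  move=> c'3 /andP[cyc' un'].
  have /C_uniq C'E : is_cycle (cycle_edges c').
    exists c'; split=> //; apply/andP; split=> //.
    by apply: sub_cycle cyc' => x y /andP[].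
  move: stC; rewrite C'E => /imsetP[x xc' stE].
  by have := next_cycle cyc' xc'; rewrite /e' -stE eqxx andbF.
have G0 : (0 < #|G|)%N by apply/card_gt0P; exists s.
have := acyclic_edge_count [set: G] e'_sym e'_irr acyc; rewrite cardsT.
have -> : (2 * #|G| = 2 * #|G|.-1 + 2)%N by lia.
rewrite -(leq_add2r 2); apply: leq_trans.
have -> : (\sum_(x in [set: G]) \sum_(y in [set: G]) e' x y = \sum_x \sum_y e' x y)%N.
  by apply: eq_big => [x|x _]; rewrite ?inE //; apply: eq_bigl => y; rewrite inE.
rewrite !sum_rel_card.
have card2 : (#|[set (s, t); (t, s)]| <= 2)%N by rewrite cards2; case: (_ != _).
apply: leq_trans (leq_add (leqnn _) card2); apply: leq_trans (leq_card_setU _ _).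
apply/subset_leq_card/subsetP => -[x y]; rewrite !inE /= /e' => exy.
rewrite exy /=; case: (eqVneq [set x; y] [set s; t]) => //= stE.
have := set21 x y; have := set22 x y; rewrite stE !inE !xpair_eqE.
have : x != y by apply: contraTneq exy => ->; rewrite sedge_irr.
move=> neq /orP[]/eqP yE /orP[]/eqP xE; rewrite xE yE ?eqxx ?orbT //.
  by rewrite xE yE eqxx in neq.
by rewrite xE yE eqxx in neq.
Qed.

(** * Pairs at distance at least 3 *)

(** A walk of length at most 2, phrased through edges so that case analyses need no tuples. *)
Definition near (G : sgraph) (x y : G) : bool :=
  [|| x == y, sedge x y | [exists c, sedge x c && sedge c y]].

Lemma near_sym (G : sgraph) : symmetric (@near G).
Proof.
move=> x y; rewrite /near eq_sym sedge_sym; congr [|| _, _ | _].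
by apply: eq_existsb => c; rewrite andbC sedge_sym [sedge c x]sedge_sym.
Qed.

(** Termwise form of the bound on the distance sum: 2 per pair, less 1 if adjacent, plus 1 if far.
    With [3 <= #|G|], a distance of at most 2 is never the default value and so comes from a
    walk. *)
Lemma dist_ge_near (G : sgraph) (x y : G) :
  (3 <= #|G|)%N -> ((x != y) + (x != y) + ~~ near x y <= dist x y + sedge x y)%N.
Proof.
move=> G3; have : ~~ near x y -> (2 < dist x y)%N.
  move=> far; rewrite ltnNge; apply: contra far => d2.
  have /dist_walk/existsP[p] : (dist x y < #|G|)%N by lia.
  have : size p = dist x y by rewrite size_tuple.
  case: (tval p) => [|c [|d [|]]] /=; rewrite ?andbT /near.
  - by move=> _ ->.
  - by move=> _ /andP[xc /eqP <-]; rewrite xc orbT.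
  - move=> _ /andP[/andP[xc cd] /eqP <-].
    by apply/or3P; apply: Or33; apply/existsP; exists c; rewrite xc cd.
  - by move=> ? ? dE; rewrite -dE in d2.
have : (x != y) -> ~~ sedge x y -> (1 < dist x y)%N.
  move=> neq nxy; rewrite ltnNge; apply/negP => d1.
  have /dist_walk/existsP[p] : (dist x y < #|G|)%N by lia.
  have : size p = dist x y by rewrite size_tuple.
  case: (tval p) => [|c [|]] /=; rewrite ?andbT ?(negPf neq) //.
  - by move=> _ /andP[xc /eqP cy]; rewrite -cy xc in nxy.
  - by move=> ? ? dE; rewrite -dE in d1.
have := dist_eq0 x y; case: (eqVneq x y) => [->|neq] /=.
  by rewrite /near eqxx.
rewrite /near (negPf neq) /=.
case: (sedge x y) => /= /negbT; rewrite -lt0n => d0; first by move=> _ _; lia.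
by move/(_ isT isT); case: existsP => _ /= d1 => [_|/(_ isT)]; lia.
Qed.

Lemma sum_transmission_ge (G : sgraph) :
  (3 <= #|G|)%N ->
  (2 * (#|G| * #|G|.-1) + \sum_(x : G) \sum_y ~~ near x y <=
   \sum_(x : G) transmission x + \sum_(x : G) \sum_y sedge x y)%N.
Proof.
move=> G3.
have neqE : (#|G| * #|G|.-1 = \sum_(x : G) \sum_y (x != y))%N.
  rewrite -sum_nat_const; apply: eq_bigr => x _.
  rewrite -(cardC1 x) -sum1_card big_mkcond; apply: eq_bigr => y _.
  by rewrite !inE eq_sym.
rewrite mul2n -addnn neqE -!big_split /=; apply: leq_sum => x _.
by rewrite -!big_split; apply: leq_sum => y _; apply: dist_ge_near.
Qed.

(** * Trees of depth two with one extra edge *)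

(* par sends each vertex to its parent in a breadth-first tree rooted at u,
   and u to itself. *)
Definition depth2_tree (G : sgraph) (u : G) (par : G -> G) : Prop :=
  [/\ par u = u, forall x, par (par x) = u,
      forall x, x != u -> sedge x (par x) & forall x, sedge u x -> par x = u].

(* With s = t there is no extra edge. *)
Definition tree_plus_edge (G : sgraph) (par : G -> G) (s t : G) : Prop :=
  forall x y, sedge x y ->
    [\/ par x = y, par y = x, x = s /\ y = t | x = t /\ y = s].

Lemma near_all_depth2_tree (G : sgraph) (u : G) :
  (forall x, near u x) -> exists par, depth2_tree u par.
Proof.
move=> u_near.
(* The default in [odflt] is never reached: a vertex near [u], but neither equal nor adjacent to it,
   shares a neighbour with it. *)
pose par x := if (x == u) || sedge u x then u else
  odflt u [pick c | sedge u c && sedge c x].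
exists par; have parP x : x != u -> ~~ sedge u x -> sedge u (par x) && sedge (par x) x.
  move=> xu ux; rewrite /par (negPf xu) (negPf ux) /=; case: pickP => //= nopar.
  have := u_near x; rewrite /near eq_sym (negPf xu) (negPf ux) /=.
  by case/existsP => c; rewrite nopar.
have par1 x : sedge u x -> par x = u by rewrite /par => ->; rewrite orbT.
have paru : par u = u by rewrite /par eqxx.
split=> // x.
  have [->|xu] := eqVneq x u; first by rewrite !paru.
  have [/par1 ->|ux] := boolP (sedge u x); first by rewrite paru.
  by have /andP[/par1] := parP x xu ux.
move=> xu; have [ux|ux] := boolP (sedge u x); first by rewrite par1 // sedge_sym.
by have /andP[_] := parP x xu ux; rewrite sedge_sym.
Qed.

(** The tree edges fill [2 * (#|G| - 1)] ordered pairs, leaving at most two, which must be the two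
    orientations of one edge. *)
Lemma depth2_tree_extra_edge (G : sgraph) (u : G) (par : G -> G) :
  depth2_tree u par -> (\sum_(x : G) \sum_y sedge x y <= 2 * #|G|)%N ->
  exists s t, tree_plus_edge par s t.
Proof.
case=> paru parpar par_edge par1; rewrite sum_rel_card; set E := [set p | _] => E_card.
pose U := [set (x, par x) | x in predC1 u].
pose D := [set (par x, x) | x in predC1 u].
have U_card : #|U| = #|G|.-1 by rewrite card_imset ?cardC1 // => x y [].
have D_card : #|D| = #|G|.-1 by rewrite card_imset ?cardC1 // => x y [].
(* A common pair would make [y'] its own grandparent, but every grandparent is [u]. *)
have UD0 : U :&: D = set0.
  apply/eqP; rewrite -subset0; apply/subsetP => -[x y]; rewrite inE.
  case/andP=> /imsetP[x' _ [-> ->]] /imsetP[y' y'u [xE yE]].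
  rewrite inE in y'u; have := parpar y'; rewrite -xE yE => y'0.
  by rewrite y'0 eqxx in y'u.
have G0 : (0 < #|G|)%N by apply/card_gt0P; exists u.
have TE : U :|: D \subset E.
  apply/subsetP => p; rewrite !inE => /orP[] /imsetP[x]; rewrite !inE => xu -> /=.
    exact: par_edge.
  by rewrite sedge_sym par_edge.
have X_card : (#|E :\: (U :|: D)| <= 2)%N.
  rewrite cardsD (setIidPr TE) cardsU UD0 cards0 U_card D_card; lia.
have notX x y : sedge x y -> (x, y) \notin E :\: (U :|: D) ->
    par x = y \/ par y = x.
  move=> xy; rewrite !inE /= xy andbT negbK.
  by case/orP=> /imsetP[z _ [-> ->]]; [left | right].
have [X0|] := set_0Vmem (E :\: (U :|: D)).
  exists u, u => x y /notX; rewrite X0 inE => /(_ isT)[]; first by constructor 1.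
  by constructor 2.
case=> -[s t] stX; exists s, t => x y xy.
have [xyX|/(notX _ _ xy)[]] := boolP ((x, y) \in E :\: (U :|: D)); last first.
- by constructor 2.
- by constructor 1.
have st : s != t.
  by move: stX; rewrite !inE => /andP[_]; apply: contraTneq => ->; rewrite sedge_irr.
have tsX : (t, s) \in E :\: (U :|: D).
  move: stX; rewrite !inE /= sedge_sym => /andP[+ ->]; rewrite andbT.
  apply: contra => /orP[] /imsetP[z zu [-> ->]]; apply/orP; [right|left];
  by apply/imsetP; exists z.
have XE : [set (s, t); (t, s)] = E :\: (U :|: D).
  apply/eqP; rewrite eqEcard cards2 xpair_eqE (negPf st) /= X_card andbT.
  by apply/subsetP => p; rewrite !inE => /orP[] /eqP ->; move: stX tsX; rewrite !inE.
move: xyX; rewrite -XE !inE !xpair_eqE => /orP[] /andP[/eqP -> /eqP ->].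
  by constructor 3.
by constructor 4.
Qed.

(** The edges at [u] form a spanning star. The edge count allows at most one further edge, and the
    cycle forces one. *)
Lemma star_plus_of_dominating (G : sgraph) (u : G) :
  unicyclic G -> (forall x, x != u -> sedge u x) -> isomorphic G (star_plus #|G|).
Proof.
move=> uni dom; have E_card := unicyclic_edge_count uni.
have tree : depth2_tree u (fun=> u).
  by split=> // x xu; rewrite sedge_sym dom.
have [s0 [t0 st0]] := depth2_tree_extra_edge tree E_card.
(* The cycle has an edge avoiding [u]: if it passes through [u], the one joining the next two
   vertices; otherwise any of its edges. *)
have [s [t [su tu st]]] : exists s t, [/\ s != u, t != u & sedge s t].
  case: uni => _ [_ [[c [c3 /andP[c_cyc c_un] _]] _]].
  have [uc|uc] := boolP (u \in c).
    have [i c' cE] := rot_to uc.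
    move: c_cyc c_un c3; rewrite -(rot_cycle i) -(rot_uniq i) -(size_rot i) {}cE.
    case: c' => [|s [|t c']] //= /and3P[_ st _] /andP[uc' _] _.
    exists s, t; split=> //; apply: contraNneq uc' => ->; by rewrite !inE eqxx ?orbT.
  case: c c3 c_cyc uc {c_un} => [|s [|t c']] //= _ /andP[st _].
  rewrite !inE !negb_or => /and3P[su tu _].
  by exists s, t; rewrite ![_ == u]eq_sym.
have edgeE x y : sedge x y =
    [|| (x != y) && ((x == u) || (y == u)), (x == s) && (y == t) | (x == t) && (y == s)].
  apply/idP/idP => [xy|].
    have xy_neq : x != y by apply: contraTneq xy => ->; rewrite sedge_irr.
    rewrite xy_neq /=; have := st0 x y xy; have := st0 s t st.
    case=> [us|ut|[-> ->]|[-> ->]]; try by rewrite ?us ?ut eqxx in su tu.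
      by case=> [->|->|[-> ->]|[-> ->]]; rewrite !eqxx ?orbT.
    by case=> [->|->|[-> ->]|[-> ->]]; rewrite !eqxx ?orbT.
  case/or3P=> [/andP[neq /orP[]/eqP xy]|/andP[/eqP -> /eqP ->]//|/andP[/eqP -> /eqP ->]].
  - by rewrite xy dom // -xy eq_sym.
  - by rewrite xy sedge_sym dom // -xy.
  - by rewrite sedge_sym.
have st_neq : s != t by apply: contraTneq st => ->; rewrite sedge_irr.
(* Position in [l] is the isomorphism, sending [u], [s], [t] to 0, 1, 2. *)
pose l := [:: u, s, t & [seq x <- enum G | x \notin [:: u; s; t]]].
have l_un : uniq l.
  rewrite /l /= !inE !negb_or !mem_filter !inE !eqxx !orbT /= filter_uniq ?enum_uniq //.
  by rewrite ![u == _]eq_sym su tu st_neq.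
have l_all x : x \in l.
  rewrite /l -[[:: u, s, t & _]]/([:: u; s; t] ++ _) mem_cat mem_filter mem_enum.
  by case: (x \in _).
have l_size : size l = #|G|.
  by rewrite -(card_uniqP l_un); apply: eq_card => x; rewrite l_all.
have idx x : (index x l < #|G|)%N by rewrite -l_size index_mem l_all.
pose f (x : G) : star_plus #|G| := Ordinal (idx x).
have f_inj : injective f.
  move=> x y /(congr1 val) fxy; rewrite -(nth_index u (l_all x)).
  by rewrite -[index x l]/(val (f x)) fxy nth_index.
exists f; split; first by apply: inj_card_bij; rewrite ?card_ord.
move=> x y; rewrite [LHS]/(star_plus_edge (f x) (f y)) /star_plus_edge /star_edge.
rewrite (inj_eq f_inj) edgeE /f /=.
have i0 z : (index z l == 0%N) = (z == u) by rewrite /l /= [u == z]eq_sym; case: (z == u).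
have i1 z : (index z l == 1%N) = (z == s).
  rewrite /l /= ![_ == z]eq_sym; case: (eqVneq z u) => [->|_].
    by rewrite [u == s]eq_sym (negPf su).
  by case: (z == s).
have i2 z : (index z l == 2%N) = (z == t).
  rewrite /l /= ![_ == z]eq_sym; case: (eqVneq z u) => [->|_].
    by rewrite [u == t]eq_sym (negPf tu).
  case: (eqVneq z s) => [->|_]; first by rewrite (negPf st_neq).
  by case: (z == t).
by rewrite !i0 !i1 !i2.
Qed.

(** * Counting far pairs in a tree of depth two with one extra edge *)

(** [F] holds at most one orientation of each pair, so it is disjoint from its image under
    swapping. *)
Lemma sum_rel_ge (T : finType) (r : rel T) (F : {set T * T}) :
  symmetric r -> (forall p, p \in F -> r p.1 p.2 /\ (p.2, p.1) \notin F) ->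
  (2 * #|F| <= \sum_x \sum_y r x y)%N.
Proof.
move=> r_sym FP; rewrite sum_rel_card.
pose swap (p : T * T) := (p.2, p.1).
have swap_inj : injective swap by move=> [x y] [x' y'] [-> ->].
have F0 : F :&: [set swap p | p in F] = set0.
  apply/eqP; rewrite -subset0; apply/subsetP => p.
  rewrite inE => /andP[+ /imsetP[q qF pE]].
  by rewrite pE => /(negP (FP q qF).2).
have := cardsU F [set swap p | p in F].
rewrite F0 cards0 card_imset // subn0 addnn -mul2n => <-.
apply/subset_leq_card/subsetP => p.
rewrite !inE => /orP[/FP[] //|/imsetP[q /FP[] rq _ ->]].
by rewrite r_sym.
Qed.

(** Along tree edges alone, [z] reaches only [par z] at depth 1 within two steps; the extra edge
    opens at most one more endpoint. *)
Lemma near_depth1 (G : sgraph) (u : G) (par : G -> G) (s t : G) :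
  depth2_tree u par ->
  tree_plus_edge par s t ->
  forall z, par z != u -> exists w, forall x, x != u -> par x = u -> near z x ->
    x = par z \/ x = w.
Proof.
case=> paru parpar par_edge par1 edge z /eqP zu.
have irr (x : G) : ~ sedge x x by rewrite sedge_irr.
(* If [z] is an end of the extra edge, [w] is the other end when that has parent [u], and its parent
   otherwise. If not, the extra edge can only be used from [par z], and [w] is its other end. *)
exists (if z == s then if par t == u then t else par t
   else if z == t then if par s == u then s else par s
   else if par z == s then t else s) => x /eqP xu px.
have hz := parpar z; have ht := parpar t; have hs := parpar s.
case/or3P => [/eqP zx|/edge zx|/existsP[c /andP[zc cx]]].
- by rewrite zx in zu.
- by case: zx => [?|?|[? ?]|[? ?]]; repeat case: eqP => ?;
    try (by left; congruence); right; congruence.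
have cu : c <> u by move=> cu; apply: zu; apply: par1; rewrite sedge_sym -cu.
have neq_zc : z <> c by move=> E; apply: (irr c); rewrite -{1}E.
have neq_cx : c <> x by move=> E; apply: (irr c); rewrite {2}E.
have hc := parpar c; have [?|?|[? ?]|[? ?]] := edge _ _ zc;
  have [?|?|[? ?]|[? ?]] := edge _ _ cx; repeat case: eqP => ?;
  try congruence; try (by left; congruence); right; congruence.
Qed.

Lemma far_depth2_depth1 (G : sgraph) (u : G) (par : G -> G) (s t : G) :
  depth2_tree u par ->
  tree_plus_edge par s t ->
  (2 * (#|[set x | par x != u]| * (#|[set x | (x != u) && (par x == u)]| - 2)) <=
   \sum_(x : G) \sum_y ~~ near x y)%N.
Proof.
move=> tree edge; set N2 := [set x | par x != u]; set N1 := [set x | _ && _].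
have /choice[w wP] : forall z, exists w, par z != u -> forall x, x != u -> par x = u ->
    near z x -> x = par z \/ x = w.
  move=> z; have [->|zu] := eqVneq (par z) u; first by exists u.
  by have [w wP] := near_depth1 tree edge zu; exists w.
pose N := [set p in setX N2 N1 | near p.1 p.2].
(* Each [z] at depth 2 gives at most the near pairs with [par z] and with [w z]. *)
have N_card : (#|N| <= 2 * #|N2|)%N.
  apply: (@leq_trans #|[set (z, par z) | z in N2] :|: [set (z, w z) | z in N2]|).
    apply/subset_leq_card/subsetP => -[z x]; rewrite !inE /=.
    case/andP=> /and3P[zu xu /eqP px] zx.
    by have [->|->] := wP z zu x xu px zx; rewrite imset_f ?orbT // inE.
  rewrite mul2n -addnn; apply: leq_trans (leq_card_setU _ _) _.
  by apply: leq_add; apply: leq_imset_card.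
pose F := setX N2 N1 :\: N.
have F_card : (#|N2| * (#|N1| - 2) <= #|F|)%N.
  have := cardsID N (setX N2 N1); rewrite (setIidPr _).
    by rewrite cardsX -/F mulnBr; lia.
  by apply/subsetP => p; rewrite !inE => /andP[].
apply: leq_trans (_ : 2 * #|F| <= _)%N; first by rewrite leq_mul2l F_card.
apply: sum_rel_ge => [x y|[x y]]; first by rewrite near_sym.
rewrite !inE /= => /andP[+ /and3P[xu yu /eqP yu']].
by rewrite xu yu yu' eqxx /= => ->.
Qed.

(** The midpoint of a walk of length 2 is [u], forcing [x = a] and [y = b], or lies in a branch, and
    then one step of the walk crosses. *)
Lemma near_cross_branches (G : sgraph) (u : G) (par : G -> G) (a b x y : G) :
  depth2_tree u par ->
  (forall x, [\/ x = u, x = a \/ par x = a | x = b \/ par x = b]) ->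
  a <> b -> a <> u -> b <> u -> par a = u -> par b = u ->
  x = a \/ par x = a -> y = b \/ par y = b -> near x y ->
  [\/ x = a /\ y = b, sedge x y,
      exists c, [/\ c = a \/ par c = a, sedge x c & sedge c y]
    | exists c, [/\ c = b \/ par c = b, sedge x c & sedge c y]].
Proof.
case=> paru parpar par_edge par1 all ab au bu pa pb xA yB.
case/or3P => [/eqP xy|xy|/existsP[c /andP[xc cy]]].
- by case: xA yB => ? [?|?]; congruence.
- by constructor 2.
have [cu|cA|cB] := all c.
- constructor 1; rewrite cu in xc cy.
  have {}xc : par x = u by apply: par1; rewrite sedge_sym.
  have {}cy := par1 y cy; split; case: xA yB => ? [?|?]; congruence.
- by constructor 3; exists c.
by constructor 4; exists c.
Qed.

(** The edge [pq] crosses between branches, so it is the extra edge. Hence [xp] is a tree edge and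
    leads to the parent of [p]. *)
Lemma branch_extra_edge (G : sgraph) (u : G) (par : G -> G) (s t a b x p q : G) :
  depth2_tree u par ->
  tree_plus_edge par s t ->
  a <> b -> a <> u -> b <> u -> par a = u -> par b = u ->
  x = a \/ par x = a -> par p = a -> q = b \/ par q = b ->
  sedge x p -> sedge p q -> x = a.
Proof.
case=> paru parpar par_edge par1 edge ab au bu pa pb xA pA qB xp pq.
have neq_xp : x <> p by move=> E; have := sedge_irr x; rewrite {2}E xp.
have neq_pq : p <> q by move=> E; have := sedge_irr p; rewrite {2}E pq.
by have [?|?|[? ?]|[? ?]] := edge _ _ xp; have [?|?|[? ?]|[? ?]] := edge _ _ pq;
  case: xA => ?; case: qB => ?; congruence.
Qed.

(** No tree edge joins the two branches, so a crossing edge is the extra edge, and the branches fix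
    its orientation. *)
Lemma cross_edge_unique (G : sgraph) (u : G) (par : G -> G) (s t a b x y x' y' : G) :
  depth2_tree u par ->
  tree_plus_edge par s t ->
  a <> b -> a <> u -> b <> u -> par a = u -> par b = u ->
  x = a \/ par x = a -> y = b \/ par y = b -> sedge x y ->
  x' = a \/ par x' = a -> y' = b \/ par y' = b -> sedge x' y' ->
  x = x' /\ y = y'.
Proof.
case=> paru parpar par_edge par1 edge ab au bu pa pb xA yB xy xA' yB' xy'.
by have [?|?|[? ?]|[? ?]] := edge _ _ xy; have [?|?|[? ?]|[? ?]] := edge _ _ xy';
  split; case: xA => ?; case: yB => ?; case: xA' => ?; case: yB' => ?; congruence.
Qed.

Lemma far_two_branches (G : sgraph) (u : G) (par : G -> G) (s t a b : G) :
  depth2_tree u par ->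
  tree_plus_edge par s t ->
  (forall x, [\/ x = u, x = a \/ par x = a | x = b \/ par x = b]) ->
  a <> b -> a <> u -> b <> u -> par a = u -> par b = u ->
  (0 < #|[set x | par x == a]|)%N -> (0 < #|[set x | par x == b]|)%N ->
  (2 < #|[set x | par x == a]| + #|[set x | par x == b]|)%N ->
  (2 * (#|[set x | par x == a]| + #|[set x | par x == b]| - 1) <=
   \sum_(x : G) \sum_y ~~ near x y)%N.
Proof.
move=> tree edge all ab au bu pa pb.
set A := [set x | par x == a]; set B := [set x | par x == b] => A0 B0 AB.
pose A' := a |: A; pose B' := b |: B.
have A'P x : reflect (x = a \/ par x = a) (x \in A').
  by rewrite !inE; apply: (iffP orP) => -[/eqP|/eqP]; by [left|right].
have B'P x : reflect (x = b \/ par x = b) (x \in B').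
  by rewrite !inE; apply: (iffP orP) => -[/eqP|/eqP]; by [left|right].
have A'_card : #|A'| = #|A|.+1 by rewrite cardsU1 inE pa eq_sym; move/eqP/negPf: au => ->.
have B'_card : #|B'| = #|B|.+1 by rewrite cardsU1 inE pb eq_sym; move/eqP/negPf: bu => ->.
have disj x : x \in A' -> x \in B' -> False.
  by move=> /A'P xA /B'P xB; case: xA => ?; case: xB => ?; congruence.
have far_of (F : {set G * G}) :
    (forall x y, (x, y) \in F -> [/\ x \in A', y \in B' & ~ near x y]) ->
    (2 * #|F| <= \sum_(x : G) \sum_y ~~ near x y)%N.
  move=> FP; apply: sum_rel_ge => [x y|[x y] /FP[xA yB /negP far]].
    by rewrite near_sym.
  by split=> //=; apply/negP => /FP[yA _ _]; apply: disj yA yB.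
(* [(p, q)] is the crossing edge. If there is none, [(a, b)] stands in for it, hence the proviso
   [p <> a]. *)
have [p [q [pA qB pq_uniq pq]]] : exists p q, [/\ p \in A', q \in B',
    forall x y, x \in A' -> y \in B' -> sedge x y -> x = p /\ y = q &
    p <> a -> sedge p q].
  have [/existsP[[p q] /and3P[/= pA qB pq]]|none] :=
    boolP [exists p : G * G, [&& p.1 \in A', p.2 \in B' & sedge p.1 p.2]].
    exists p, q; split=> // x y /A'P xA /B'P yB xy.
    apply: cross_edge_unique tree edge ab au bu pa pb xA yB xy _ _ pq; first exact/A'P.
    exact/B'P.
  exists a, b; split; rewrite ?setU11 // => x y xA yB xy.
  by case/negP: none; apply/existsP; exists (x, y); rewrite /= xA yB.
have nearP x y : x \in A' -> y \in B' -> near x y -> [\/ x = a /\ y = b, x = p /\ y = q,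
    sedge x p /\ y = q | x = p /\ sedge q y].
  move=> xA yB xy; have [|xy'|[c [cA xc cy]]|[c [cB xc cy]]] :=
    near_cross_branches tree all ab au bu pa pb (A'P _ xA) (B'P _ yB) xy.
  - by constructor 1.
  - by constructor 2; apply: pq_uniq.
  - by constructor 3; have [<- ->] := pq_uniq c y (introT (A'P _) cA) yB cy.
  - by constructor 4; have [-> <-] := pq_uniq x c xA (introT (B'P _) cB) xc.
(* If [p = a] or [q = b], every near cross pair has first entry [p] or second entry [q]. The
   [#|A| * #|B|] others suffice, since [(#|A| - 1) * (#|B| - 1) >= 0]. *)
have [pqab|] := boolP ((p == a) || (q == b)).
  pose F := setX (A' :\ p) (B' :\ q).
  apply: (@leq_trans (2 * #|F|)); last first.
    apply: far_of => x y; rewrite in_setX !in_setD1.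
    case/andP=> /andP[/eqP xp xA] /andP[/eqP yq yB]; split=> // /nearP.
    case/(_ xA yB) => [[xa yb]|[]|[]|[]] //.
    by case/orP: pqab => /eqP ?; congruence.
  have := cardsD1 p A'; have := cardsD1 q B'.
  rewrite cardsX pA qB A'_card B'_card; nia.
rewrite negb_or => /andP[/eqP pa' /eqP qb'].
have {}pq := pq pa'.
(* Now [a] is the only neighbour of [p] in its branch, and [b] that of [q], so at most four cross
   pairs are near. [(#|A| + 1) * (#|B| + 1) - 4] is large enough because [#|A| * #|B| >= 2]. *)
pose N := [set (a, b); (p, q); (p, b); (a, q)].
apply: (@leq_trans (2 * #|setX A' B' :\: N|)); last first.
  apply: far_of => x y; rewrite in_setD in_setX => /andP[xyN /andP[xA yB]]; split=> //.
  have pA2 : par p = a by case/A'P: pA.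
  have qB2 : par q = b by case/B'P: qB.
  have qp : sedge q p by rewrite sedge_sym.
  move/(nearP _ _ xA yB) => near_xy; case/negP: xyN; rewrite !inE !xpair_eqE.
  case: near_xy => [[-> ->]|[-> ->]|[xp ->]|[-> qy]]; rewrite ?eqxx ?orbT //.
    rewrite (branch_extra_edge tree edge ab au bu pa pb (A'P _ xA) pA2 (B'P _ qB) xp pq).
    by rewrite !eqxx ?orbT.
  have ba : b <> a by move=> E; apply: ab.
  rewrite sedge_sym in qy.
  rewrite (branch_extra_edge tree edge ba bu au pb pa (B'P _ yB) qB2 (A'P _ pA) qy qp).
  by rewrite !eqxx ?orbT.
have N4 : (#|N| <= 4)%N by rewrite /N !cardsU !cards1; lia.
have NS : (#|setX A' B' :&: N| <= #|N|)%N by rewrite subset_leq_card ?subsetIr.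
have := cardsID N (setX A' B'); rewrite cardsX A'_card B'_card.
have : (0 < (#|A| - 1) + (#|B| - 1))%N by lia.
nia.
Qed.

(** * The count of far pairs in unicyclic graphs, and the conclusion *)

Lemma unicyclic_far_count (G : sgraph) :
  (8 <= #|G|)%N -> unicyclic G -> ~ isomorphic G (star_plus #|G|) ->
  (#|G| <= \sum_(x : G) \sum_y ~~ near x y)%N.
Proof.
move=> G8 uni niso.
have [/existsP[u0 u0_near]|nocentre] :=
  boolP [exists u : G, [forall y, near u y]]; last first.
  rewrite -sum1_card; apply: leq_sum => x _.
  have [y xy] : exists y, ~~ near x y.
    apply/existsP; rewrite -negb_forall; apply: contra nocentre => ?.
    by apply/existsP; exists x.
  by rewrite (bigD1 y) //= xy.
have [u /forallP u_near u_max] := @arg_maxnP _ u0 (fun u : G => [forall y, near u y])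
  (fun u => #|[set y | sedge u y]|) u0_near.
have [par tree] := near_all_depth2_tree u_near.
have [s [t edge]] := depth2_tree_extra_edge tree (unicyclic_edge_count uni).
have far := far_depth2_depth1 tree edge.
have [paru parpar par_edge par1] := tree.
set N1 := [set x | (x != u) && (par x == u)] in far.
set N2 := [set x | par x != u] in far.
have N1E : N1 = [set y | sedge u y].
  apply/setP => x; rewrite !inE; apply/andP/idP => [[xu /eqP px]|ux].
    by rewrite sedge_sym -px par_edge.
  by rewrite (par1 x ux) eqxx; split=> //; apply: contraTneq ux => ->; rewrite sedge_irr.
have N12 : (#|N1| + #|N2| = #|G|.-1)%N.
  rewrite -(cardsC1 u) -(cardsID N2 [set~ u]) addnC; congr (_ + _)%N.
    by apply: eq_card => x; rewrite !inE; case: (eqVneq x u) => // ->; rewrite paru eqxx.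
  by apply: eq_card => x; rewrite !inE negbK andbC.
have N2_0 : (0 < #|N2|)%N.
  rewrite card_gt0; apply: contra_notN niso => /eqP N20.
  apply: (star_plus_of_dominating uni (u := u)) => x xu.
  have : x \notin N2 by rewrite N20 inE.
  by rewrite inE negbK => /eqP px; rewrite sedge_sym -px par_edge.
have N1_0 : (0 < #|N1|)%N.
  have [z] := card_gt0P N2_0; rewrite inE => zu; apply/card_gt0P; exists (par z).
  by rewrite inE zu parpar eqxx.
(* If all of [N2] hangs from [a], then [a] is near every vertex and adjacent to [u] and [N2];
   maximality of the degree of [u] gives [#|N2| < #|N1|]. *)
have branch a : a \in N1 -> (#|[set x | par x == a]| < #|N2|)%N || (#|N2| < #|N1|)%N.
  move=> aN1; have [//|le /=] := ltnP.
  have sub : [set x | par x == a] \subset N2.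
    by apply/subsetP => x; rewrite !inE => /eqP ->; move: aN1; rewrite inE => /andP[].
  have Na x : par x != u -> par x = a.
    move=> xu; have : x \in [set x | par x == a].
      by have /eqP -> : [set x | par x == a] == N2; rewrite ?eqEcard ?sub ?le ?inE.
    by rewrite inE => /eqP.
  have ua : sedge u a by have := aN1; rewrite N1E inE.
  have a_near y : near a y.
    rewrite /near; have [->|yu] := eqVneq y u; first by rewrite sedge_sym ua orbT.
    have [py|/Na py] := eqVneq (par y) u.
      apply/orP; right; apply/orP; right; apply/existsP; exists u.
      by rewrite sedge_sym ua -py sedge_sym par_edge.
    by rewrite -py [sedge (par y) y]sedge_sym par_edge ?orbT.
  have := u_max a; rewrite -N1E => /(_ (introT forallP a_near)).
  apply: leq_trans; rewrite -add1n.
  have <- : #|u |: N2| = (1 + #|N2|)%N by rewrite cardsU1 inE paru eqxx.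
  apply/subset_leq_card/subsetP => y; rewrite !inE => /orP[/eqP ->|/Na py].
    by rewrite sedge_sym.
  rewrite -py sedge_sym par_edge //; apply: contraTneq aN1 => yu.
  by rewrite inE -py yu paru eqxx.
(* The factors [#|N2|] and [#|N1| - 2] are positive with sum [#|G| - 3], so twice their product is
   at least [2 * (#|G| - 4)]. This reaches [#|G|] from order 8 on. *)
have [N1_3|N1_2] := leqP 3 #|N1|.
  by apply: leq_trans far; nia.
(* A single neighbour [a] of [u] would carry all of [N2], against [branch]. *)
have [N1_1|N1_1] := leqP #|N1| 1.
  have /cards1P[a N1a] : #|N1| == 1%N by rewrite eqn_leq N1_1.
  have := branch a; rewrite N1a set11 => /(_ isT).
  have -> : [set x | par x == a] = N2.
    apply/setP => x; rewrite !inE; apply/eqP/idP => [->|xu].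
      by have : a \in N1; [rewrite N1a set11 | rewrite inE => /andP[]].
    by have : par x \in N1; [rewrite inE xu parpar eqxx | rewrite N1a inE => /eqP].
  rewrite ltnn /= cards1; lia.
have /cards2P[a [b [ab N1ab]]] : #|N1| == 2%N by rewrite eqn_leq -ltnS N1_2.
have aN1 : a \in N1 by rewrite N1ab set21.
have bN1 : b \in N1 by rewrite N1ab set22.
have := branch a aN1; have := branch b bN1.
move: aN1 bN1; rewrite !inE => /andP[/eqP au /eqP pa] /andP[/eqP bu /eqP pb].
have N1P x : x != u -> par x = u -> x = a \/ x = b.
  move=> xu px; have : x \in N1 by rewrite inE xu px eqxx.
  by rewrite N1ab !inE => /orP[]/eqP; [left|right].
have N2E : (#|N2| = #|[set x | par x == a]| + #|[set x | par x == b]|)%N.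
  have <- : [set x | par x == a] :|: [set x | par x == b] = N2.
    apply/setP => x; rewrite !inE; apply/orP/idP => [[]/eqP -> //|xu]; try exact/eqP.
    by case: (N1P _ xu (parpar x)) => ->; [left|right].
  rewrite cardsU (_ : _ :&: _ = set0) ?cards0 ?subn0 //.
  by apply/setP => x; rewrite !inE; case: eqP => //= ->; apply/negbTE.
have all x : [\/ x = u, x = a \/ par x = a | x = b \/ par x = b].
  have [->|xu] := eqVneq x u; first by constructor 1.
  have [px|px] := eqVneq (par x) u.
    by case: (N1P x xu px) => ->; [constructor 2|constructor 3]; left.
  by case: (N1P _ px (parpar x)) => ->; [constructor 2|constructor 3]; right.
(* As [#|N2| = #|G| - 3] exceeds [#|N1| = 2], [branch] shows that neither branch carries all of
   [N2], so both are nonempty; the bound is again [2 * (#|G| - 4)]. *)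
have far2 := far_two_branches tree edge all (elimN eqP ab) au bu pa pb.
move=> ? ?; apply: leq_trans (far2 _ _ _); lia.
Qed.

Theorem theorem5p2 (R : realType) (alpha : R) (n : nat) (G : sgraph) :
  0 <= alpha -> alpha < 1 -> (8 <= n)%N -> #|G| = n -> unicyclic G ->
  alpha_spectral_radius alpha (star_plus n) <= alpha_spectral_radius alpha G /\
  (alpha_spectral_radius alpha G = alpha_spectral_radius alpha (star_plus n)
   <-> isomorphic G (star_plus n)).
Proof.
move=> a0 a1 n8 Gn uni; have [iso|niso] := EM (isomorphic G (star_plus n)).
  by rewrite (alpha_spectral_radius_isomorphic alpha iso).
suff lt : alpha_spectral_radius alpha (star_plus n) < alpha_spectral_radius alpha G.
  by split; [exact: ltW | split=> // eq_radius; rewrite eq_radius ltxx in lt].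
apply: lt_le_trans (star_plus_radius_lt _ _) _; rewrite ?a0 //; first lia.
have n0 : (0 < #|G|)%N by lia.
rewrite -(ler_pM2r (x := #|G|%:R)) ?ltr0n //.
apply: le_trans (sum_transmission_le _ n0); last by rewrite a0 ltW.
rewrite -natrM ler_nat.
have edges := unicyclic_edge_count uni.
have far : (#|G| <= \sum_(x : G) \sum_y ~~ near x y)%N.
  by apply: unicyclic_far_count => //; rewrite Gn.
have G3 : (3 <= #|G|)%N by lia.
(* The distance sum is at least [2 * n * (n - 1) - 2 * n + n = n * (2 * n - 3)]. *)
have := sum_transmission_ge G3; move: n0 edges far; rewrite Gn; nia.
Qed.
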